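(* Let $(T,X)$ be a semiflow on a compact Hausdorff space $X$ with $T$ an abelian semigroup. If $(T,X)$ is weakly almost periodic and has a dense set of almost periodic points, then $(T,X)$ is uniformly almost periodic.
   Context: $X$ is a compact Hausdorff space with its (symmetric) uniform structure $\mathscr{U}_X$; for $x\in X$ and $\varepsilon\in\mathscr{U}_X$ write $\varepsilon[x]=\{y\in X : (x,y)\in\varepsilon\}$. A semiflow $(T,X)$ consists of a topological semigroup $T$ with neutral element $e$ and a jointly continuous map $T\times X\to X$, $(t,x)\mapsto tx$, with $ex=x$ and $(ts)x=t(sx)$ for all $s,t\in T$, $x\in X$. A subset $A\subseteq T$ is syndetic if there is a compact $K\subseteq T$ with $Kt\cap A\neq\emptyset$ for every $t\in T$. A point $x\in X$ is almost periodic for $(T,X)$ if for every neighborhood $V$ of $x$ the set $\{t\in T: tx\in V\}$ is syndetic in $T$. $(T,X)$ is weakly almost periodic if for every $f\in C(X,\mathbb{R})$ the set $Tf=\{f_t : t\in T\}$, where $f_t(x)=f(tx)$, is relatively compact in $C(X,\mathbb{R})$ (the continuous real functions on $X$) with the topology of pointwise convergence. $(T,X)$ is uniformly almost periodic if for every $\varepsilon\in\mathscr{U}_X$ there is a syndetic subset $A$ of $T$ such that $Ax\subseteq\varepsilon[x]$ for all $x\in X$. *)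

(* Defs.v *)
From HB Require Import structures.
From mathcomp Require Import all_boot all_order all_algebra.
From mathcomp Require Import all_classical reals topology normedtype.

Set Implicit Arguments.
Unset Strict Implicit.
Unset Printing Implicit Defensive.

Import numFieldNormedType.Exports.
Local Open Scope classical_set_scope.

(* A topological semigroup with neutral element; no separation axiom is
   imposed on the topology. *)
HB.mixin Record hasContinuousMul T of Topological T & Monoid T := {
  mulg_continuous : continuous (fun p : T * T => (p.1 * p.2)%g)
}.

#[short(type="topologicalMonoidType")]
HB.structure Definition TopologicalMonoid :=
  {T of Topological T & Monoid T & hasContinuousMul T}.

Record semiflow (T : topologicalMonoidType) (X : topologicalType) := Semiflow {
  act :> T -> X -> X;
  act_continuous : continuous (fun p : T * X => act p.1 p.2);
  act1 : forall x, act 1%g x = x;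
  actM : forall s t x, act (s * t)%g x = act s (act t x)
}.

Definition syndetic (T : topologicalMonoidType) (A : set T) :=
  exists2 K : set T, compact K &
    forall t : T, [set (k * t)%g | k in K] `&` A !=set0.

Definition almost_periodic (T : topologicalMonoidType) (X : topologicalType)
    (a : semiflow T X) (x : X) :=
  forall V : set X, nbhs x V -> syndetic [set t | V (a t x)].

(* C(X, R) with the topology of pointwise convergence: the initial topology
   for the inclusion into the product space {ptws X -> R}. *)
Definition Cp (R : realType) (X : topologicalType) : topologicalType :=
  initial_topology (fun f : continuousType X R => (f : X -> R) : {ptws X -> R}).

Lemma translate_continuous (R : realType) (T : topologicalMonoidType)
    (X : topologicalType) (a : semiflow T X) (f : continuousType X R) (t : T) :
  continuous (fun x => f (a t x)).
Proof.
move=> x; apply: (@continuous_comp _ _ _ (a t) f); last exact: cts_fun.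
apply: (@cvg_comp _ _ _ (fun y => (t, y)) (fun p => a p.1 p.2)
  _ (nbhs (t, x))); last exact: (@act_continuous _ _ a (t, x)).
by apply: cvg_pair; [exact: cvg_cst | exact: cvg_id].
Qed.

Definition translate (R : realType) (T : topologicalMonoidType)
    (X : topologicalType) (a : semiflow T X) (f : continuousType X R) (t : T) :
    continuousType X R :=
  mkcts (@translate_continuous R T X a f t).

(* precompact A is compactness of closure A, here the closure within C(X, R)
   and not within the space of all functions X -> R. *)
Definition weakly_almost_periodic (R : realType) (T : topologicalMonoidType)
    (X : topologicalType) (a : semiflow T X) :=
  forall f : continuousType X R,
    precompact ([set translate a f t | t in [set: T]] : set (Cp R X)).

Definition uniformly_almost_periodic (T : topologicalMonoidType)
    (X : uniformType) (a : semiflow T X) :=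
  forall E : set (X * X), entourage E ->
    exists2 A : set T, syndetic A &
      forall x : X, [set a t x | t in A] `<=` xsection E x.

(* Main.v *)
(* Weak almost periodicity makes every element of the Ellis semigroup E, the
   pointwise closure of the maps x |-> t x, continuous; hence E is commutative
   and has a least ideal, which contains an idempotent u. It fixes the almost
   periodic points, so u = id by density and E is a group. Return sets to
   neighborhoods of id in E are then syndetic, and it remains to see that E is
   equicontinuous at id. Otherwise, since the maps x |-> t x are onto, one can
   build g_n in T and pairs (x_n, y_n) with g_i x_k and g_i y_k close for
   i <= k, but g_n x_k and g_n y_k apart for k < n. For cluster points p of
   (g_n) and (x, y) of (x_n, y_n), continuity of p makes p x and p y at once
   close and apart. *)
Require Import Defs.
From mathcomp Require Import all_boot all_order all_algebra.
From mathcomp Require Import finmap.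
From mathcomp Require Import all_classical reals topology normedtype.

Set Implicit Arguments.
Unset Strict Implicit.
Unset Printing Implicit Defensive.

Import Order.TTheory GRing.Theory Num.Theory.
Import numFieldNormedType.Exports.
Local Open Scope classical_set_scope.

(** * Closures, cluster points and equalizers *)

Lemma closure_min (S : topologicalType) (A C : set S) :
  closed C -> A `<=` C -> closure A `<=` C.
Proof. by move=> clC AC; rewrite closureE; apply: smallest_sub. Qed.

Lemma cluster_closed (S : topologicalType) (F : set_system S) (C : set S) :
  closed C -> F C -> cluster F `<=` C.
Proof.
move=> clC FC p clFp; apply: clC; move: clFp; rewrite clusterE; exact.
Qed.

Lemma closed_equalizer (S Y : topologicalType) (f g : S -> Y) :
  hausdorff_space Y -> continuous f -> continuous g ->
  closed [set s | f s = g s].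
Proof.
move=> hY cf cg s cls; apply: hY => A B fsA gsB.
have nbhsAB : nbhs s (f @^-1` A `&` g @^-1` B).
  by apply: filterI; [exact: cf | exact: cg].
have [r [/= fg [Ar Br]]] := cls _ nbhsAB.
by exists (f r); split=> //; rewrite fg.
Qed.

Lemma continuous_map_pair (S Y : topologicalType) (f : S -> Y) :
  continuous f -> continuous (fun z : S * S => (f z.1, f z.2)).
Proof.
move=> cf [x y]; apply: cvg_pair => /=.
  by apply: (@cvg_comp _ _ _ fst f _ (nbhs x)); [exact: cvg_fst | exact: cf].
by apply: (@cvg_comp _ _ _ snd f _ (nbhs y)); [exact: cvg_snd | exact: cf].
Qed.

(** * The topology of pointwise convergence *)

Section PointwiseConvergence.
Context {U : topologicalType} {V : uniformType}.

Lemma ptws_eval_continuous (x : U) :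
  continuous (fun h : {ptws U -> V} => h x).
Proof.
move=> h; have : {ptws, nbhs (h : {ptws U -> V}) --> h} by apply: cvg_id.
by move=> /pointwise_cvgP; apply.
Qed.

Lemma ptws_eval2_continuous (x y : U) :
  continuous (fun h : {ptws U -> V} => (h x, h y)).
Proof.
move=> h.
exact: (cvg_pair (@ptws_eval_continuous x h) (@ptws_eval_continuous y h)).
Qed.

Lemma ptws_continuous (S : topologicalType) (f : S -> {ptws U -> V}) :
  (forall x, continuous (fun s => f s x)) -> continuous f.
Proof.
move=> cf s.
have [_ cvgf] :=
  @pointwise_cvgP U V (f @ s) (f s) (fmap_filter f (nbhs_filter s)).
by apply: cvgf => x; exact: cf.
Qed.

Lemma ptws_compact : compact [set: V] -> compact [set: {ptws U -> V}].
Proof.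
move=> cV; have := @tychonoff {classic U} (fun=> V) (fun=> setT) (fun=> cV).
by rewrite (_ : [set f | _] = setT) //; exact/seteqP.
Qed.

Lemma ptws_hausdorff : hausdorff_space V -> hausdorff_space {ptws U -> V}.
Proof. by move=> hV; apply: (@hausdorff_product {classic U} (fun=> V)). Qed.

End PointwiseConvergence.

Lemma ptws_postcomp_continuous (U : topologicalType) (V W : uniformType)
    (q : V -> W) : continuous q ->
  continuous ((fun h => q \o h) : {ptws U -> V} -> {ptws U -> W}).
Proof.
move=> qc; apply: ptws_continuous => x h.
apply: (@continuous_comp _ _ _ (fun h : {ptws U -> V} => h x) q).
  exact: ptws_eval_continuous.
exact: qc.
Qed.

Lemma ptws_precomp_continuous (U U' : topologicalType) (V : uniformType)
    (g : U' -> U) :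
  continuous ((fun h => h \o g) : {ptws U -> V} -> {ptws U' -> V}).
Proof. by apply: ptws_continuous => x; exact: ptws_eval_continuous. Qed.

(** * Closed and open entourages *)

Section Entourages.
Context {X : uniformType}.

Lemma entourage_split3 (E : set (X * X)) : entourage E ->
  exists F, [/\ entourage F, forall x y, F (x, y) -> F (y, x) &
    forall x y z w, F (x, y) -> F (y, z) -> F (z, w) -> E (x, w)].
Proof.
move=> entE; pose G := split_ent (split_ent E).
have entG : entourage G by do 2 apply: entourage_split_ent.
exists (G `&` (G^-1)%relation); split; first exact: entourage_invI.
  by move=> x y [].
move=> x y z w [xy _] [yz _] [zw _].
apply: (entourage_split z) => //; first exact: (entourage_split y).
exact: split_ent_subset.
Qed.

(** A point [(x, y)] of [closure F] is [F]-close to some [(u, v)] in [F], so [x], [u], [v], [y] is a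
    chain of three [F]-steps. *)
Lemma closed_entourage (E : set (X * X)) : entourage E ->
  exists C, [/\ entourage C, closed C & C `<=` E].
Proof.
move=> /entourage_split3[F [entF symF FE]]; exists (closure F); split.
- by apply: filterS (entF) => z; exact: subset_closure.
- exact: closed_closure.
move=> [x y] /(_ (xsection F x `*` xsection F y))[].
  by exists (xsection F x, xsection F y) => //=; split; exact: nbhs_entourage.
move=> [u v] [Fuv [/= /xsectionP xu /xsectionP /symF vy]].
exact: FE xu Fuv vy.
Qed.

Lemma entourage_interior (E : set (X * X)) : entourage E -> entourage E°.
Proof.
move=> /entourage_split3[F [entF symF FE]]; apply: filterS (entF) => -[x y] Fxy.
exists (xsection F x, xsection F y) => /=.
  by split; exact: nbhs_entourage.
move=> [u v] [/= /xsectionP /symF ux /xsectionP yv].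
exact: FE ux Fxy yv.
Qed.

Lemma entourage_nbhs_diag (E : set (X * X)) (x : X) :
  entourage E -> nbhs (x, x) E.
Proof.
by move=> /entourage_interior entE; exact: (entourage_refl x entE).
Qed.

End Entourages.

(* The library's [compact_cover] requires a pointed space. *)
Lemma compact_finite_cover (S : topologicalType) (I : choiceType) (K : set S)
    (f : I -> set S) :
  compact K -> (forall x, K x -> exists i, nbhs x (f i)) ->
  exists F : {fset I}, forall x, K x -> exists2 i, i \in F & f i x.
Proof.
move=> /compact_near_coveringP cK Kf.
(* [sup] is the filter of finite sets growing under inclusion. *)
pose sup := filter_from setT (fun F : {fset I} => [set G | (F `<=` G)%fset]).
have supF : Filter sup.
  apply: filter_from_filter; first by exists fset0.
  move=> F G _ _; exists (F `|` G)%fset => // H /=.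
  by rewrite fsubUset => /andP[FH GH]; split.
have [x Kx|F _ FK] := cK _ sup (fun F x => exists2 i, i \in F & f i x) supF.
  have [i fi] := Kf x Kx.
  exists (f i, [set G | ([fset i] `<=` G)%fset]).
    by split=> //; exists [fset i]%fset.
  by move=> [y G] /= [fiy]; rewrite fsub1set; exists i.
by exists F => x Kx; apply: (FK F) => /=.
Qed.

(** Each [x] has its own [M]-section as a neighborhood. The finite net lets conditions at finitely
    many [z] control every [x]. *)
Lemma nbhs_diag_net (S : topologicalType) (M : set (S * S)) :
  compact [set: S] -> (forall x : S, nbhs (x, x) M) ->
  exists F : {fset S}, forall x, exists2 z, z \in F & M (z, x).
Proof.
move=> cS Mdiag.
have [x _|F FS] :=
    @compact_finite_cover S S setT (fun z => [set x | M (z, x)]) cS.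
  exists x; apply: (cvg_pair (cvg_cst x) cvg_id); exact: Mdiag.
by exists F => x; exact: FS.
Qed.

(** * The Ellis semigroup and continuity of its elements *)

Definition ellis (T : topologicalMonoidType) (X : uniformType)
  (a : semiflow T X) : set {ptws X -> X} :=
  closure (range (a : T -> {ptws X -> X})).

Section EllisSemigroup.
Context {R : realType} {T : topologicalMonoidType} {X : uniformType}.
Context (a : semiflow T X).

Lemma act_ellis t : ellis a (a t).
Proof. by apply: subset_closure; exists t. Qed.

Arguments act_ellis : clear implicits.

Lemma idfun_ellis : ellis a idfun.
Proof.
rewrite (_ : idfun = a 1%g); first exact: act_ellis.
by apply/funext => x; rewrite act1.
Qed.

Lemma act_comp s t : a s \o a t = a (s * t)%g.
Proof. by apply/funext => x; rewrite actM. Qed.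

Lemma semiflow_continuous t : continuous (a t).
Proof.
move=> x; apply: (@cvg_comp _ _ _ (fun y => (t, y)) (fun p => a p.1 p.2)
  _ (nbhs (t, x))); last exact: (@act_continuous _ _ a (t, x)).
by apply: cvg_pair; [exact: cvg_cst | exact: cvg_id].
Qed.

Lemma ellis_closed : closed (ellis a).
Proof. exact: closed_closure. Qed.

Lemma ellis_compact : compact [set: X] -> compact (ellis a).
Proof.
move=> cX; apply: (@subclosed_compact _ _ setT) => //.
  exact: ellis_closed.
exact: ptws_compact.
Qed.

(** By complete regularity it is enough that [f \o p] is continuous for every real continuous [f],
    and weak almost periodicity keeps the pointwise limits of the translates of [f] continuous. *)
Lemma ellis_continuous (p : {ptws X -> X}) : hausdorff_space X ->
  weakly_almost_periodic R a -> ellis a p -> continuous p.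
Proof.
move=> hX wap ap.
have fp_continuous (f : continuousType X R) : continuous (f \o p).
  pose K : set (Cp R X) :=
    closure ([set translate a f t | t in [set: T]] : set (Cp R X)).
  pose i (g : Cp R X) : {ptws X -> R} := (g : continuousType X R).
  have ci : continuous i by exact: initial_continuous.
  have cK : compact (i @` K).
    apply: continuous_compact; first exact: continuous_subspaceT.
    by rewrite /K -precompactE; exact: wap.
  (* Compactness makes the image closed among all functions, although [K] is a closure within C(X)
     only. *)
  have clK : closed (i @` K).
    by apply: compact_closed cK; apply: ptws_hausdorff; exact: Rhausdorff.
  have /(_ p ap)[g _ <-] : ellis a `<=`
      (fun h : {ptws X -> X} => (f \o h : {ptws X -> R})) @^-1` (i @` K).
    apply: closure_min.
      apply: preimage_closed clK => h _; apply: ptws_postcomp_continuous.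
      exact: cts_fun.
    move=> _ [t _ <-]; exists (translate a f t) => //.
    by apply: subset_closure; exists t.
  exact: cts_fun.
move=> x V nbhsV.
(* [f] is 0 at [p x] and 1 off the interior of [V], so [f (p y) < 1] forces [p y] into [V]. *)
have [f [cf _ f0 f1]] : exists f : X -> R, [/\ continuous f,
    range f `<=` `[0%R, 1%R]%classic, f @` [set p x] `<=` [set 0%R] &
    f @` (~` V°) `<=` [set 1%R]].
  apply/uniform_separatorP; apply: (@point_uniform_separator R).
    by rewrite closedC; exact: open_interior.
  by move=> /(_ nbhsV).
have fpx : f (p x) = 0%R by apply: f0; exists (p x).
have cvgfp : f (p y) @[y --> x] --> 0%R.
  by rewrite -fpx; exact: (fp_continuous (mkcts cf) x).
have : \forall y \near x, (f (p y) < 1)%R by exact: cvgr_lt cvgfp _ ltr01.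
apply: filterS => y fpy1.
apply: contrapT => nVpy; move: fpy1.
by rewrite (f1 (f (p y))) ?ltxx//; exists (p y) => // /interior_subset.
Qed.

(** * Algebra of the Ellis semigroup *)

Context (cptX : compact [set: X]) (hausX : hausdorff_space X).
Context (abelT : forall s t : T, (s * t = t * s)%g).
Context (ellis_cts : forall p, ellis a p -> continuous (p : X -> X)).

(** One factor is approximated at a time: precomposition is always continuous, and postcomposition
    is once [p] has become a continuous [a t]. *)
Lemma ellis_comp (p q : {ptws X -> X}) :
  ellis a p -> ellis a q -> ellis a (p \o q).
Proof.
move=> ap aq; move: p ap.
apply: (@closure_min _ _ [set p : {ptws X -> X} | ellis a (p \o q)]).
  apply: (@preimage_closed _ _
    (fun p : {ptws X -> X} => p \o q : {ptws X -> X})).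
    by move=> ? _; exact: ptws_precomp_continuous.
  exact: ellis_closed.
move=> _ [t _ <-] /=; move: q aq.
apply: (@closure_min _ _ [set q : {ptws X -> X} | ellis a (a t \o q)]).
  apply: (@preimage_closed _ _
    (fun q : {ptws X -> X} => a t \o q : {ptws X -> X})).
    by move=> ? _; apply: ptws_postcomp_continuous; exact: semiflow_continuous.
  exact: ellis_closed.
by move=> _ [s _ <-] /=; rewrite act_comp; exact: act_ellis.
Qed.

(** Two passages to the closure as in [ellis_comp]; the equation is closed in [p] because [q] is
    continuous. *)
Lemma ellis_comm (p q : {ptws X -> X}) :
  ellis a p -> ellis a q -> p \o q = q \o p.
Proof.
move=> ap aq; move: p ap.
apply: (@closure_min _ _ [set p : {ptws X -> X} | p \o q = q \o p]).
  apply: (closed_equalizer (ptws_hausdorff hausX)).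
    exact: ptws_precomp_continuous.
  by apply: ptws_postcomp_continuous; exact: ellis_cts.
move=> _ [t _ <-] /=; move: q aq.
apply: (@closure_min _ _ [set q : {ptws X -> X} | a t \o q = q \o a t]).
  apply: (closed_equalizer (ptws_hausdorff hausX)).
    by apply: ptws_postcomp_continuous; exact: semiflow_continuous.
  exact: ptws_precomp_continuous.
by move=> _ [s _ <-] /=; rewrite !act_comp abelT.
Qed.

(** By commutativity the compact sets [ideal p] are directed downwards, so they have a common point
    [q]. *)
Lemma ellis_minimal_idempotent : exists u : {ptws X -> X},
  [/\ ellis a u, u \o u = u &
      forall p, ellis a p -> exists2 r, ellis a r & r \o p = u].
Proof.
pose ideal (p : {ptws X -> X}) : set {ptws X -> X} :=
  [set r \o p | r in ellis a].
have ideal_closed p : closed (ideal p).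
  apply: compact_closed; first exact: ptws_hausdorff.
  apply: continuous_compact; last exact: ellis_compact.
  by apply: continuous_subspaceT; exact: ptws_precomp_continuous.
have idealP p : ellis a p -> ideal p `<=` ellis a.
  by move=> ap _ [r ar <-]; exact: ellis_comp.
pose F := filter_from (ellis a) ideal.
have FF : ProperFilter F.
  apply: filter_from_proper; last first.
    by move=> p ap; exists (idfun \o p), idfun => //; exact: idfun_ellis.
  apply: filter_from_filter; first by exists idfun; exact: idfun_ellis.
  move=> p q ap aq; exists (p \o q); first exact: ellis_comp.
  move=> _ [r ar <-]; split.
    by rewrite (ellis_comm ap aq); exists (r \o q) => //; exact: ellis_comp.
  by exists (r \o p) => //; exact: ellis_comp.
have [|q [aq clFq]] := ellis_compact cptX FF.
  by exists idfun; [exact: idfun_ellis | exact/idealP/idfun_ellis].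
have qmin p : ellis a p -> exists2 r, ellis a r & r \o p = q.
  by move=> ap; apply: (cluster_closed (ideal_closed p)) clFq; exists p.
(* [q] lies in [ideal (q \o q)], say [s q q = q]; commutativity then gives
   [s q s q = s (s q q) = s q]. *)
have [s as_ sqq] := qmin _ (ellis_comp aq aq).
exists (s \o q); split; first exact: ellis_comp.
  rewrite -[LHS]/(s \o ((q \o s) \o q)) -(ellis_comm as_ aq).
  by rewrite -[LHS]/(s \o (s \o (q \o q))) sqq.
move=> p ap; have [r ar <-] := qmin p ap.
by exists (s \o r) => //; exact: ellis_comp.
Qed.

(* If [u] is idempotent and [y = u x], the closed set of [z] with [k z] in [V]
   for some [k] in a compact set meeting all return times contains the orbit of
   [x], hence [y]; so [x] is a limit of fixed points [k y] of [u]. *)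
Lemma idempotent_fix_almost_periodic (u : {ptws X -> X}) (x : X) :
  ellis a u -> u \o u = u -> almost_periodic a x -> u x = x.
Proof.
move=> au uu apx.
have act_u t z : a t (u z) = u (a t z).
  exact: (congr1 (fun h : X -> X => h z) (ellis_comm (act_ellis t) au)).
have uuE z : u (u z) = u z by exact: (congr1 (fun h : X -> X => h z) uu).
have clfix : closed [set z | u z = z].
  apply: (closed_equalizer hausX); first exact: ellis_cts.
  exact: (fun=> cvg_id).
apply: clfix => V nbhsV.
have [V' nbhsV' clV'V] := @uniform_regular X x V nbhsV.
have [K cK VK] := apx _ nbhsV'.
pose D := [set z | exists2 k, K k & closure V' (a k z)].
have clD : closed D.
  move=> z clDz; apply: contrapT => nDz.
  (* Joint continuity of the action and compactness of [K] give one neighborhood of [z] that serves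
     all [k]. *)
  have near_notD : \forall z' \near z, K `<=` (fun k => ~ closure V' (a k z')).
    have := proj1 (compact_near_coveringP K) cK.
    move=> /(_ X (nbhs z) (fun z' k => ~ closure V' (a k z')) _); apply => k Kk.
    apply: (@act_continuous _ _ a (k, z) (~` closure V')).
    apply: open_nbhs_nbhs; split; first by rewrite openC; exact: closed_closure.
    by move=> Vkz; apply: nDz; exists k.
  have [z' [[k Kk Vkz'] /(_ k Kk)]] := clDz _ near_notD.
  exact.
have [k Kk Vkux] : D (u x).
  have : ellis a `<=` (fun h : {ptws X -> X} => h x) @^-1` D.
    apply: closure_min.
      by apply: preimage_closed clD => h _; exact: ptws_eval_continuous.
    move=> _ [t _ <-] /=; have [_ [[k Kk <-] Vktx]] := VK t.
    by exists k => //; apply: subset_closure; rewrite -actM.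
  exact.
exists (a k (u x)); split; last exact: clV'V.
by rewrite /= -act_u uuE.
Qed.

(** The fixed points of [u] form a closed dense set, so [u] is the identity and its minimality reads
    as invertibility. *)
Lemma dense_almost_periodic_ellis_group :
  dense [set x : X | almost_periodic a x] ->
  forall p, ellis a p -> exists2 r, ellis a r & r \o p = idfun.
Proof.
move=> denseX.
have [u [au uu umin]] := ellis_minimal_idempotent.
suff -> : idfun = u by [].
apply/funext => x; have clfix : closed [set z | z = u z].
  apply: (closed_equalizer hausX); last exact: ellis_cts.
  exact: (fun=> cvg_id).
apply: clfix => V; rewrite nbhsE => -[O [oO Ox] OV].
have [z [Oz apz]] := denseX O (ex_intro _ x Ox) oO.
exists z; split; last exact: OV.
by rewrite /= (idempotent_fix_almost_periodic au uu apz).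
Qed.

(** * Syndetic return sets and equicontinuity at the identity *)

Context (ellis_group :
  forall p, ellis a p -> exists2 r, ellis a r & r \o p = idfun).

(** Commutativity makes the left inverse of [a t] a right inverse. *)
Lemma act_surjective t x : exists y, a t y = x.
Proof.
have [r ar rt] := ellis_group (act_ellis t); exists (r x).
have tr := ellis_comm (act_ellis t) ar.
by rewrite -[LHS]/((a t \o r) x) tr rt.
Qed.

(** If [r] inverts [p], any [a t] near [r] brings [p] near the identity. By compactness finitely
    many [t] suffice for all [p], in particular for every [a s]. *)
Lemma syndetic_return_idfun (N : set {ptws X -> X}) :
  nbhs (idfun : {ptws X -> X}) N -> syndetic [set t | N (a t)].
Proof.
rewrite nbhsE => -[O [oO Oid] ON].
have preO t : open [set p : {ptws X -> X} | O (a t \o p)].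
  apply: open_comp oO => p _; apply: ptws_postcomp_continuous.
  exact: semiflow_continuous.
have [p ap|F FE] := @compact_finite_cover _ T _
    (fun t => [set p : {ptws X -> X} | O (a t \o p)]) (ellis_compact cptX).
  have [r ar rp] := ellis_group ap.
  have nbhsr : nbhs r [set q : {ptws X -> X} | O (q \o p)].
    apply: (@ptws_precomp_continuous _ _ _ p r O).
    by apply: open_nbhs_nbhs; split=> //; rewrite rp.
  have [_ [[t _ <-] Otp]] := ar _ nbhsr.
  by exists t; apply: open_nbhs_nbhs; split.
exists [set` F]; first exact/finite_compact/finite_fset.
move=> s; have [t Ft Ots] := FE _ (act_ellis s).
exists (t * s)%g; split; first by exists t.
by apply: ON; move: Ots; rewrite /= act_comp.
Qed.

Lemma entourage_nbhs_diag_act (V : set (X * X)) t (x : X) :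
  entourage V -> nbhs (x, x) [set y | V (a t y.1, a t y.2)].
Proof.
move=> entV; have := continuous_map_pair (@semiflow_continuous t).
by move=> /(_ (x, x) V); apply; exact: entourage_nbhs_diag.
Qed.

(** A single entourage [E] is violated, so a sequence suffices without metrizability of [X]. The
    contradiction comes from taking two limits in either order. *)
Lemma ellis_equicontinuous_idfun (E : set (X * X)) : entourage E ->
  exists2 N, nbhs (idfun : {ptws X -> X}) N &
    forall t, N (a t) -> forall x, E (x, a t x).
Proof.
move=> /entourage_split3[G [entG symG GE]].
(* With [V] closed inside the interior of [V'], being in [V] and being outside [V'°] are disjoint
   closed conditions, both kept in limits. *)
have [V' [entV' clV' V'G]] := closed_entourage entG.
have [V [entV clV VV']] := closed_entourage (entourage_interior entV').
have VG w : V w -> G w.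
  by move=> Vw; apply: V'G; apply: interior_subset; exact: VV'.
apply: contrapT => noN.
have bad N : nbhs (idfun : {ptws X -> X}) N ->
    exists t x, N (a t) /\ ~ E (x, a t x).
  move=> nbhsN; apply: contrapT => good; apply: noN; exists N => // t Nt x.
  by apply: contrapT => nE; apply: good; exists t, x.
(* A state is an element [g] of [T], a neighborhood of its action confining the
   later ones, and a neighborhood of the diagonal confining the later pairs. *)
pose state := {s : T * set {ptws X -> X} * set (X * X) |
  [/\ open s.1.2, s.1.2 (a s.1.1), forall x : X, nbhs (x, x) s.2 &
      forall z, s.2 z -> V (a s.1.1 z.1, a s.1.1 z.2)]}.
pose U_ (s : state) := (sval s).1.2.
pose M_ (s : state) := (sval s).2.
pose next (s s' : state) := [/\ U_ s' `<=` U_ s, M_ s' `<=` M_ s &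
  exists2 z, M_ s z & U_ s' `<=` [set h | ~ V' (h z.1, h z.2)]].
have step s : {s' | next s s'}.
  apply: cid; case: s => [[[g U] M] /= [oU Ug nbhsM MV]].
  have [F FM] := nbhs_diag_net cptX nbhsM.
  (* For [a t] in [N], [t * g] stays confined by [U], and [t] moves each net point [a g z] only
     within [V]. *)
  pose N := [set h : {ptws X -> X} | U (h \o a g)] `&`
    \bigcap_(z in [set` F]) [set h : {ptws X -> X} | V (a g z, h (a g z))].
  have nbhsN : nbhs (idfun : {ptws X -> X}) N.
    apply: filterI.
      apply: (@ptws_precomp_continuous _ _ _ (a g) idfun U).
      exact: open_nbhs_nbhs.
    apply: filter_bigI => z _.
    apply: (@ptws_eval_continuous _ _ (a g z) idfun (fun y => V (a g z, y))).
    apply: (cvg_pair (cvg_cst (a g z)) cvg_id).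
    exact: entourage_nbhs_diag.
  have [t [x' [[Utg FV] nE]]] := bad N nbhsN.
  (* Surjectivity writes the point that [t] moves too far as [a g x], so that the net applies to
     [x]. *)
  have [x gx] := act_surjective g x'; subst x'.
  have [z Fz Mzx] := FM x.
  (* Otherwise the chain [g x], [g z], [t g z], [t g x] would put [(g x, t g x)] in [E]. *)
  have nV' : ~ V' (a t (a g z), a t (a g x)).
    move=> V'tg; apply: nE; apply: (GE _ (a g z) (a t (a g z))).
    - by apply: symG; apply: VG; exact: (MV (z, x)).
    - by apply: VG; exact: FV.
    - exact: V'G.
  pose U' := U `&` [set h : {ptws X -> X} | ~ V' (h z, h x)].
  pose M' := M `&` [set y | V (a (t * g)%g y.1, a (t * g)%g y.2)].
  have inv : [/\ open U', U' (a (t * g)%g),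
      forall x : X, nbhs (x, x) M' &
      forall y, M' y -> V (a (t * g)%g y.1, a (t * g)%g y.2)].
    split; last by move=> y [].
    - apply: openI oU _.
      apply: (@open_comp _ _ (fun h : {ptws X -> X} => (h z, h x)) (~` V')).
        by move=> h _; exact: ptws_eval2_continuous.
      by rewrite openC.
    - by split; [rewrite -act_comp | rewrite /= !actM].
    move=> y; apply: filterI => //.
    exact: entourage_nbhs_diag_act.
  exists (exist _ (t * g, U', M')%g inv); split=> [h []|y []|] //=.
  by exists (z, x) => // h [].
have s0 : state.
  exists (1%g, setT, [set y : X * X | V (a 1%g y.1, a 1%g y.2)]).
  split=> //=; first exact: openT.
  by move=> x; exact: entourage_nbhs_diag_act.
have [f [_ fnext]] := dependent_choice step s0.
have fpair n : {y : X * X | M_ (f n) y /\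
    U_ (f n.+1) `<=` [set h | ~ V' (h y.1, h y.2)]}.
  by apply: cid; have [_ _ [y My Uy]] := fnext n; exists y.
pose z n := sval (fpair n); have zP n := svalP (fpair n).
have leU m n : (m <= n)%N -> U_ (f n) `<=` U_ (f m).
  elim: n => [|n IH]; first by rewrite leqn0 => /eqP->.
  rewrite leq_eqVlt => /predU1P[-> //|/IH Um] h; have [Un _ _] := fnext n.
  by move=> /Un; exact: Um.
have leM m n : (m <= n)%N -> M_ (f n) `<=` M_ (f m).
  elim: n => [|n IH]; first by rewrite leqn0 => /eqP->.
  rewrite leq_eqVlt => /predU1P[-> //|/IH Mm] y; have [_ Mn _] := fnext n.
  by move=> /Mn; exact: Mm.
pose g n : {ptws X -> X} := a (sval (f n)).1.1.
have gU n : U_ (f n) (g n).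
  by case: (svalP (f n)).
have gV i n : (i <= n)%N -> V (g i (z n).1, g i (z n).2).
  move=> /leM Mi; case: (svalP (f i)) => _ _ _; apply.
  by apply: Mi; case: (zP n).
have gnV' k n : (k < n)%N -> ~ V' (g n (z k).1, g n (z k).2).
  by move=> /leU Uk; have [_ ] := zP k; apply; apply: Uk.
have [p [ap clgp]] : ellis a `&` cluster (g @ \oo) !=set0.
  by apply: ellis_compact => //; exists 0%N => // n _; exact: act_ellis.
have [y [_ clzy]] : [set: X * X] `&` cluster (z @ \oo) !=set0.
  have := compact_setX cptX cptX; rewrite setXTT; apply; exact: filterT.
(* First the pairs converge for fixed [i], by continuity of [g i]; then [g i] converges at the fixed
   pair [y]. *)
have pV : V (p y.1, p y.2).
  have : closed [set h : {ptws X -> X} | V (h y.1, h y.2)].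
    by apply: preimage_closed clV => h _; exact: ptws_eval2_continuous.
  move=> /cluster_closed; apply; last exact: clgp.
  exists 0%N => // i _ /=.
  have : closed [set w : X * X | V (g i w.1, g i w.2)].
    apply: preimage_closed clV => w _; apply: continuous_map_pair.
    exact: semiflow_continuous.
  move=> /cluster_closed; apply; last exact: clzy.
  by exists i => // n; exact: gV.
have clO : closed (~` V'°) by apply: open_closedC; exact: open_interior.
(* The opposite order: first [g n] converges at the fixed pair [z k], then the pairs converge, by
   continuity of [p]. *)
suff : (~` V'°) (p y.1, p y.2) by apply; exact: VV'.
have : closed [set w : X * X | (~` V'°) (p w.1, p w.2)].
  apply: preimage_closed clO => w _; apply: continuous_map_pair.
  exact: ellis_cts.
move=> /cluster_closed; apply; last exact: clzy.
exists 0%N => // k _ /=.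
have : closed [set h : {ptws X -> X} | (~` V'°) (h (z k).1, h (z k).2)].
  by apply: preimage_closed clO => h _; exact: ptws_eval2_continuous.
move=> /cluster_closed; apply; last exact: clgp.
(* The pair [z k] is chosen in passing to state [k.+1], so only elements from there on separate
   it. *)
by exists k.+1 => // n kn /interior_subset; exact: gnV'.
Qed.

End EllisSemigroup.

(** * Uniform almost periodicity from return times to the identity *)

Theorem theorem2p15 (R : realType) (T : topologicalMonoidType)
    (X : uniformType) (a : semiflow T X)
    (cptX : compact [set: X]) (hausX : hausdorff_space X)
    (abelT : forall s t : T, (s * t = t * s)%g)
    (wapX : weakly_almost_periodic R a)
    (denseX : dense [set x : X | almost_periodic a x]) :
  uniformly_almost_periodic a.
Proof.
have ellis_cts p : ellis a p -> continuous (p : X -> X).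
  exact: ellis_continuous.
have ellis_group :=
  dense_almost_periodic_ellis_group cptX hausX abelT ellis_cts denseX.
move=> E entE.
have [N nbhsN NE] :=
  ellis_equicontinuous_idfun cptX hausX abelT ellis_cts ellis_group entE.
exists [set t | N (a t)].
  exact: syndetic_return_idfun nbhsN.
by move=> x _ [t Nt <-]; apply/xsectionP; exact: NE.
Qed.
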